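(* Let $T=\{1,\dots,n\}$ be a set of teams with $n$ even and $R=\{1,\dots,r\}$ a set of rounds with $r$ even. Any proper balanced assignment of home-away patterns to teams $m:T\times R\to\{\mathrm H,\mathrm A\}$ can be transformed into any other proper balanced assignment of home-away patterns to teams $m':T\times R\to\{\mathrm H,\mathrm A\}$ by a finite sequence of moves in the neighborhood structure 2-Team HomeAwaySwap (2THAS).
   Context: An assignment of home-away patterns (HAPs) to teams is a function $m:T\times R\to\{\mathrm H,\mathrm A\}$, where $m(t,s)=\mathrm H$ (resp. $\mathrm A$) means team $t$ plays home (resp. away) in round $s$. The assignment $m$ is proper if for every round $s\in R$: $|\{i\in T: m(i,s)=\mathrm H\}|=|\{i\in T: m(i,s)=\mathrm A\}|=\frac n2$. The assignment $m$ is balanced if for every team $i\in T$: $|\{s\in R: m(i,s)=\mathrm H\}|=|\{s\in R: m(i,s)=\mathrm A\}|=\frac r2$. A 2THAS move on $m$ takes two distinct teams $i,j\in T$ and two distinct rounds $q,s\in R$ such that $m(i,s)\ne m(j,s)$, $m(i,s)\ne m(i,q)$ and $m(i,q)\ne m(j,q)$, and produces the assignment obtained from $m$ by swapping the values $m(i,s)$ and $m(j,s)$ and swapping the values $m(i,q)$ and $m(j,q)$, leaving all other values unchanged. *)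

(* Defs.v *)
From HB Require Import structures.
From mathcomp Require Import all_boot all_fingroup.

Set Implicit Arguments.
Unset Strict Implicit.
Unset Printing Implicit Defensive.

Variant venue := Home | Away.

Definition bool_of_venue (v : venue) : bool := if v is Home then true else false.
Definition venue_of_bool (b : bool) : venue := if b then Home else Away.
Lemma bool_of_venueK : cancel bool_of_venue venue_of_bool. Proof. by case. Qed.

HB.instance Definition _ := Finite.copy venue (can_type bool_of_venueK).

(* Teams and rounds are numbered from 0, i.e. T = 'I_n and R = 'I_r. *)
Definition assignment (n r : nat) := {ffun 'I_n * 'I_r -> venue}.

Section HAP.
Variables n r : nat.
Implicit Types m : assignment n r.

(* The halvings n./2 and r./2 round down; they are n/2 and r/2 for the even
   n and r for which these predicates are meant. *)
Definition HAP_proper m : Prop :=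
  forall s : 'I_r, #|[set i : 'I_n | m (i, s) == Home]| = n./2 /\
                   #|[set i : 'I_n | m (i, s) == Away]| = n./2.

Definition HAP_balanced m : Prop :=
  forall i : 'I_n, #|[set s : 'I_r | m (i, s) == Home]| = r./2 /\
                   #|[set s : 'I_r | m (i, s) == Away]| = r./2.

Definition swap_teams m (i j : 'I_n) (q s : 'I_r) : assignment n r :=
  [ffun p => if (p.2 == s) || (p.2 == q) then m (tperm i j p.1, p.2) else m p].

Definition move_2THAS : rel (assignment n r) := fun m m' =>
  [exists i : 'I_n, exists j : 'I_n, exists q : 'I_r, exists s : 'I_r,
    [&& i != j, q != s, m (i, s) != m (j, s), m (i, s) != m (i, q),
        m (i, q) != m (j, q) & m' == swap_teams m i j q s]].

End HAP.

(* Main.v *)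
(* Encode an assignment as a 0-1 matrix. If A and B have the same row and column
   sums and differ at (i, s), say A(i,s) = 1 and B(i,s) = 0, equality of the sums
   of row i gives q with A(i,q) = 0 and B(i,q) = 1, and equality of the sums of
   columns s and q gives j with A(j,q) + B(j,s) > A(j,s) + B(j,q). Then rows i, j
   and columns q, s carry a move on A or a move on B, and this move strictly
   decreases the Hamming distance of A and B. As moves are reversible and keep
   the row and column sums, induction on the distance concludes. *)
Require Import Defs.
From mathcomp Require Import all_boot.
From mathcomp Require Import all_fingroup.

Set Implicit Arguments.
Unset Strict Implicit.
Unset Printing Implicit Defensive.

(** Otherwise [f] is at most [g] everywhere and strictly below it at [i], which makes the sums
    differ. *)
Lemma sum_eq_ltn_ex (I : finType) (f g : I -> nat) (i : I) :
  \sum_k f k = \sum_k g k -> f i < g i -> exists j, g j < f j.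
Proof.
move=> eq_fg lt_fg; apply/existsP; apply: contraPT eq_fg => /existsPn le_fg.
apply/eqP; rewrite neq_ltn (bigD1 i) // [X in _ < X](bigD1 i) //=.
by rewrite -addSn leq_add // leq_sum // => k _; rewrite leqNgt le_fg.
Qed.

Section Switches.
Variables n r : nat.
Implicit Types (m : assignment n r) (p : 'I_n * 'I_r).

Definition home m p : bool := m p == Home.

Lemma home_inj m m' p p' : (home m p == home m' p') = (m p == m' p').
Proof. by rewrite /home; case: (m p) (m' p') => [] []. Qed.

(** The invariant of the induction: the margins need only agree, whatever their values. *)
Definition same_margins m m' : Prop :=
  (forall i, \sum_s home m (i, s) = \sum_s home m' (i, s)) /\
  (forall s, \sum_i home m (i, s) = \sum_i home m' (i, s)).

Definition distance m m' : nat := \sum_p (home m p != home m' p).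

Lemma same_margins_sym m m' : same_margins m m' -> same_margins m' m.
Proof. by case=> row col; split. Qed.

Lemma distanceC m m' : distance m m' = distance m' m.
Proof. by apply: eq_bigr => p _; rewrite eq_sym. Qed.

Lemma home_swap m i j q s p :
  home (swap_teams m i j q s) p =
  if (p.2 == s) || (p.2 == q) then home m (tperm i j p.1, p.2) else home m p.
Proof. by rewrite /home ffunE; case: ifP. Qed.

(** With only two venues, the three inequalities of a move say that rows [i], [j] and columns [s],
    [q] form a checkerboard. *)
Lemma moveP m m' :
  reflect (exists i j q s,
             [/\ i != j, q != s, home m (j, s) = ~~ home m (i, s),
                 home m (i, q) = ~~ home m (i, s) &
                 home m (j, q) = home m (i, s)] /\ m' = swap_teams m i j q s)
          (move_2THAS m m').
Proof.
apply: (iffP existsP) => [[i /existsP[j /existsP[q /existsP[s]]]]|].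
  case/and5P=> ij qs; rewrite -!home_inj => js iq /andP[jq /eqP->].
  exists i, j, q, s; split=> //; split=> //;
  by move: js iq jq; do 4!case: (home m _).
case=> i [j [q [s [[ij qs js iq jq] ->]]]].
exists i; apply/existsP; exists j; apply/existsP; exists q; apply/existsP.
exists s; rewrite ij qs eqxx -!home_inj js iq jq.
by case: (home m (i, s)).
Qed.

Lemma swap_teamsK m i j q s :
  swap_teams (swap_teams m i j q s) i j q s = m.
Proof.
apply/ffunP => -[k t]; rewrite !ffunE /=.
by case: ifP => tsq; rewrite /= tsq ?tpermK.
Qed.

(** The swap is an involution and leaves the opposite checkerboard, so the same rows and columns
    undo it. *)
Lemma move_2THAS_sym : symmetric (@move_2THAS n r).
Proof.
suff move_sym m m' : move_2THAS m m' -> move_2THAS m' m.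
  by move=> m m'; apply/idP/idP => /move_sym.
case/moveP=> i [j [q [s [[ij qs js iq jq] ->]]]]; apply/moveP.
exists i, j, q, s; rewrite swap_teamsK !home_swap /= !eqxx orbT /=.
by rewrite !tpermL !tpermR js iq jq negbK.
Qed.

Lemma move_same_margins m m' : move_2THAS m m' -> same_margins m' m.
Proof.
case/moveP=> i [j [q [s [[ij qs js iq jq] ->]]]]; split=> [k|t].
- have [kij|kij] := boolP ((k == i) || (k == j)); last first.
    apply: eq_bigr => t _; rewrite home_swap /= tpermD ?if_same //;
    by move: kij; rewrite eq_sym; case: eqVneq => //= _; rewrite eq_sym.
  (* On the two rows involved, the move also exchanges columns q and s. *)
  rewrite [RHS](reindex_inj (@perm_inj _ (tperm q s))) /=.
  apply: eq_bigr => t _; rewrite home_swap /=.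
  have [->|ts] := eqVneq t s.
    by case/orP: kij => /eqP->; rewrite ?tpermL ?tpermR ?js ?iq ?jq.
  have [->|tq] := eqVneq t q.
    by case/orP: kij => /eqP->; rewrite ?tpermL ?tpermR ?js ?iq ?jq ?negbK.
  by rewrite /= tpermD // eq_sym.
- have [tsq|tsq] := boolP ((t == s) || (t == q)).
    rewrite [RHS](reindex_inj (@perm_inj _ (tperm i j))) /=.
    by apply: eq_bigr => k _; rewrite home_swap /= tsq.
  by apply: eq_bigr => k _; rewrite home_swap /= (negbTE tsq).
Qed.

Lemma same_margins_trans m1 m2 m3 :
  same_margins m1 m2 -> same_margins m2 m3 -> same_margins m1 m3.
Proof.
move=> [row12 col12] [row23 col23].
by split=> k; rewrite ?row12 ?row23 ?col12 ?col23.
Qed.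

(** The swap repairs both disagreements in row [i]. The last hypothesis excludes the only case where
    row [j] loses as much, namely when [m] and [m'] agree at both of its cells. *)
Lemma swap_closer m m' i j q s (b : bool) :
    home m (i, s) = b -> home m' (i, s) = ~~ b ->
    home m (i, q) = ~~ b -> home m' (i, q) = b ->
    home m (j, s) = ~~ b -> home m (j, q) = b ->
    (home m' (j, q) = b -> home m' (j, s) = b) ->
  exists2 m1, move_2THAS m m1 & distance m1 m' < distance m m'.
Proof.
move=> is1 is2 iq1 iq2 js1 jq1 jsq2.
have ij : i != j by apply/eqP => E; move: is1; rewrite E js1; case: (b).
have qs : q != s by apply/eqP => E; move: is1; rewrite -E iq1; case: (b).
exists (swap_teams m i j q s).
  by apply/moveP; exists i, j, q, s; rewrite js1 iq1 is1 jq1.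
have [ji sq] : j != i /\ s != q by rewrite eq_sym ij eq_sym qs.
(* Both distances split into the four swapped cells and a common remainder. *)
have split4 (F : 'I_n * 'I_r -> nat) : \sum_p F p =
    F (i, s) + (F (i, q) + (F (j, s) + (F (j, q) +
    \sum_(p | [&& p != (i, s), p != (i, q), p != (j, s) & p != (j, q)]) F p))).
  rewrite (bigD1 (i, s)) //= (bigD1 (i, q)) /=; last first.
    by rewrite xpair_eqE eqxx.
  rewrite (bigD1 (j, s)) /=; last by rewrite !xpair_eqE (negbTE ji).
  rewrite (bigD1 (j, q)) /=; last first.
    by rewrite !xpair_eqE (negbTE ji) (negbTE qs) !andbF.
  by congr (_ + (_ + (_ + (_ + _)))); apply: eq_bigl => p; rewrite -!andbA.
rewrite /distance !split4.
set rest := (X in _ < _ + (_ + (_ + (_ + X)))).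
have -> : \sum_(p | [&& p != (i, s), p != (i, q), p != (j, s) & p != (j, q)])
    (home (swap_teams m i j q s) p != home m' p) = rest.
  apply: eq_bigr => -[k t]; rewrite !xpair_eqE home_swap /=.
  have [->|ts] := eqVneq t s.
    rewrite (negbTE sq) !andbT !andbF /= andbT => /andP[ki kj].
    by rewrite tpermD // eq_sym.
  have [->|//] := eqVneq t q; rewrite !andbT !andbF /= => /andP[ki kj].
  by rewrite tpermD // eq_sym.
rewrite !home_swap /= !eqxx orbT /= !tpermL !tpermR is1 is2 iq1 iq2 js1 jq1.
move: jsq2; case: (home m' (j, q)) (home m' (j, s)) (b).
all: case; case=> /= H; rewrite ?add0n ?add1n ?ltnS ?leqnn ?leqnSn ?leqW //.
all: by have := H erefl.
Qed.

Lemma move_closer m m' :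
    same_margins m m' -> m != m' ->
  (exists2 m1, move_2THAS m m1 & distance m1 m' < distance m m') \/
  (exists2 m1, move_2THAS m' m1 & distance m m1 < distance m m').
Proof.
move=> margins neq.
have [[i s] neq_is] : exists p, home m p != home m' p.
  apply/existsP; apply: contraNT neq => /existsPn eq_home.
  by apply/eqP/ffunP => p; apply/eqP; rewrite -home_inj -[_ == _]negbK.
(* Exchanging [m] and [m'] exchanges the two alternatives of the conclusion. *)
wlog lt_is : m m' margins {neq} neq_is / home m' (i, s) < home m (i, s).
  move=> W; have [lt_is|] := boolP (home m' (i, s) < home m (i, s)).
    exact: W.
  move=> nlt; have [] := W m' m (same_margins_sym margins).
  - by rewrite eq_sym.
  - by move: nlt neq_is; do 2!case: (home _ _).
  - by case=> m1 mv lt; right; exists m1 => //; rewrite distanceC (distanceC m).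
  - by case=> m1 mv lt; left; exists m1 => //; rewrite distanceC (distanceC m).
case: margins => row col.
have [q lt_iq] := sum_eq_ltn_ex (esym (row i)) lt_is.
(* Summed over [j], both sides agree by the column sums; at [i] the left side is 2 and the right
   side 0, so some row has the opposite strict inequality. *)
have [j] : exists j, home m (j, s) + home m' (j, q) <
                     home m (j, q) + home m' (j, s).
  apply: (@sum_eq_ltn_ex _ (fun j => home m (j, q) + home m' (j, s) : nat)
            (fun j => home m (j, s) + home m' (j, q)) i).
    by rewrite !big_split /= !col addnC.
  by move: lt_is lt_iq; do 4!case: (home _ _).
move: lt_is lt_iq.
case is1: (home m (i, s)); case is2: (home m' (i, s)) => // _.
case iq1: (home m (i, q)); case iq2: (home m' (i, q)) => // _.
case js1: (home m (j, s)); case jq1: (home m (j, q));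
case js2: (home m' (j, s)); case jq2: (home m' (j, q)) => // _.
(* If [m] is 0 at [(j, s)] and 1 at [(j, q)], it carries the move. Otherwise the inequality forces
   [m] to be equal at these two cells and [m'] to be 1 and 0 there, so [m'] carries it. *)
all: try by left; apply: (@swap_closer m m' i j q s true);
            rewrite ?is1 ?is2 ?iq1 ?iq2 ?js1 ?jq1 ?js2 ?jq2.
all: right; rewrite distanceC; have [|||||||m1 mv lt] :=
       @swap_closer m' m i j q s false;
     rewrite ?is1 ?is2 ?iq1 ?iq2 ?js1 ?jq1 ?js2 ?jq2 //;
     by exists m1 => //; rewrite distanceC.
Qed.

Lemma same_margins_connect m m' :
  same_margins m m' -> connect (@move_2THAS n r) m m'.
Proof.
have [d] := ubnP (distance m m'); elim: d => // d IH in m m' *.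
rewrite ltnS => le_d margins.
have [->|neq] := eqVneq m m'; first exact: connect0.
have [] := move_closer margins neq => -[m1 mv lt].
- apply: connect_trans (connect1 mv) (IH _ _ _ _); first exact: leq_trans le_d.
  exact: same_margins_trans (move_same_margins mv) margins.
(* A move made on the target becomes the last step of the path, taken backwards. *)
- apply: (@connect_trans _ _ m1); last first.
    by apply: connect1; rewrite move_2THAS_sym.
  apply: IH; first exact: leq_trans le_d.
  apply: same_margins_trans margins _.
  exact: same_margins_sym (move_same_margins mv).
Qed.

End Switches.

Theorem theorem4p3 (n r : nat) (n_even : ~~ odd n) (r_even : ~~ odd r)
    (m m' : assignment n r)
    (m_proper : HAP_proper m) (m_balanced : HAP_balanced m)
    (m'_proper : HAP_proper m') (m'_balanced : HAP_balanced m') :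
  exists ms : seq (assignment n r),
    path (@move_2THAS n r) m ms /\ last m ms = m'.
Proof.
have sum_home (I : finType) (P : pred I) : \sum_i P i = #|[set i | P i]|.
  by rewrite -sum1dep_card [RHS]big_mkcond; apply: eq_bigr => i _; case: (P i).
have /connectP[ms ms_path ->] : connect (@move_2THAS n r) m m'.
  apply: same_margins_connect; split=> k; rewrite !sum_home.
    by rewrite (m_balanced k).1 (m'_balanced k).1.
  by rewrite (m_proper k).1 (m'_proper k).1.
by exists ms.
Qed.
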